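(* Let $n,k\ge 1$ be integers, let $A\in\mathbb{M}(n)$, and let $\otimes^k:\mathbb{M}(n)\to\mathbb{M}(n^k)$ be the map $A\mapsto\otimes^k A$. For every $1\le m\le k$, $$\|\mathrm{D}^m\otimes^k(A)\|=\frac{k!}{(k-m)!}\,\|A\|^{k-m}.$$
   Context: $\mathbb{M}(n)$ denotes the space of $n\times n$ complex matrices, identified with the linear operators on $\mathcal{H}=\mathbb{C}^n$ (with the Euclidean norm). For a matrix $A\in\mathbb{M}(n)$, $\|A\|=\sup_{\|x\|=1}\|Ax\|$ is the operator norm; the same norm is used on $\mathbb{M}(n^k)$. The $k$-fold tensor power $\otimes^k\mathcal{H}$ is an $n^k$-dimensional Hilbert space with inner product determined by $\langle x_1\otimes\cdots\otimes x_k,y_1\otimes\cdots\otimes y_k\rangle=\prod_{i=1}^k\langle x_i,y_i\rangle$. For an orthonormal basis $e_1,\ldots,e_n$ of $\mathcal{H}$, the basis $\{e_{i_1}\otimes\cdots\otimes e_{i_k}\}$ of $\otimes^k\mathcal{H}$ is ordered lexicographically, and operators on $\otimes^k\mathcal{H}$ are thereby identified with $\mathbb{M}(n^k)$. The tensor power $\otimes^k A$ is the operator determined by $(\otimes^k A)(x_1\otimes\cdots\otimes x_k)=Ax_1\otimes\cdots\otimes Ax_k$. For an $m$-times differentiable map $f:\mathbb{M}(n_1)\to\mathbb{M}(n_2)$, $\mathrm{D}^m f(A)$ is the $m$th derivative of $f$ at $A$, regarded as a continuous $m$-linear map; it satisfies $$\mathrm{D}^m f(A)(X^1,\ldots,X^m)=\left.\frac{\partial^m}{\partial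 t_1\cdots\partial t_m}\right|_{t_1=\cdots=t_m=0}f(A+t_1X^1+\cdots+t_mX^m),$$ and its norm is $$\|\mathrm{D}^m f(A)\|=\sup_{\|X^1\|=\cdots=\|X^m\|=1}\|\mathrm{D}^m f(A)(X^1,\ldots,X^m)\|.$$ $\mathrm{D}^m\otimes^k(A)$ denotes the $m$th derivative at $A$ of the map $\otimes^k$. The convention $\|A\|^0=1$ is used (also for $A=0$). *)

(* Defs.v *)
From mathcomp Require Import all_boot all_order all_algebra.
From mathcomp Require Import all_classical all_reals all_analysis.
From mathcomp Require Import complex mxtens.

Set Implicit Arguments.
Unset Strict Implicit.
Unset Printing Implicit Defensive.

Import Order.TTheory GRing.Theory Num.Theory.
Import numFieldNormedType.Exports.

Local Open Scope classical_set_scope.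
Local Open Scope ring_scope.
Local Open Scope complex_scope.

(* The library norm on 'cV[R[i]]_n and 'M[R[i]]_n is the entrywise maximum; it
   provides the topology used by the differential 'd below. *)
Definition euclnorm (R : realType) (n : nat) (x : 'cV[R[i]]_n) : R :=
  Num.sqrt (\sum_(i < n) Normc.normc (x i 0) ^+ 2).

(* [sup] is 0 on empty sets, so this is meaningful for 0 < n. *)
Definition opnorm (R : realType) (n : nat) (A : 'M[R[i]]_n) : R :=
  sup [set euclnorm (A *m x) | x in [set x : 'cV[R[i]]_n | euclnorm x = 1]].

(* iter_diff f [:: X1; ...; Xm] A is D^m f(A)(X1, ..., Xm), with the m-linear
   map D^m f evaluated on its arguments before being differentiated again:
   D^m f(A)(X1, ..., Xm) = D(B |-> D^(m-1) f(B)(X2, ..., Xm))(A)(X1). *)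
Fixpoint iter_diff (K : numFieldType) (V W : normedModType K) (f : V -> W)
    (Xs : seq V) : V -> W :=
  if Xs is X :: Xs' then fun A => 'd (iter_diff f Xs') A X else f.

Definition mderive (K : numFieldType) (V W : normedModType K) (m : nat)
    (f : V -> W) (A : V) : m.-tuple V -> W :=
  fun X => iter_diff f X A.
Arguments mderive {K V W} m f A X.

Definition multi_opnorm (R : realType) (m p q : nat)
    (T : m.-tuple 'M[R[i]]_p -> 'M[R[i]]_q) : R :=
  sup [set opnorm (T X) |
        X in [set X : m.-tuple 'M[R[i]]_p | forall i, opnorm (tnth X i) = 1]].

(* [ntensmx] iterates the Kronecker product, i.e. the matrix of the tensor
   power in the lexicographically ordered basis. *)
Definition tensor_power (R : realType) (n k : nat) (A : 'M[R[i]]_n) :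
    'M[R[i]]_(n ^ k) :=
  ntensmx A k.
Arguments tensor_power {R n} k A.

(* Main.v *)
Require Import Defs.
From HB Require Import structures.
From mathcomp Require Import all_boot all_order all_algebra.
From mathcomp Require Import all_classical all_reals all_analysis.
From mathcomp Require Import complex mxtens.
From mathcomp Require Import ring.
Import Order.TTheory GRing.Theory Num.Theory.
Import numFieldNormedType.Exports.
Import Normc.

(** Write [A ^t k] for the k-th tensor power.  Differentiating it in the
    directions X_1, ..., X_m gives, by multilinearity, the sum over all ways of
    putting X_1, ..., X_m into m distinct slots among k and A into the k - m
    others.  There are k! / (k - m)! such placements, and the operator norm is
    multiplicative on tensor products, so each summand has norm at most
    ||A|| ^ (k - m) when the X_i have norm 1: this is the upper bound.

    It is attained.  Choose B with ||B|| = 1 and A = ||A|| B (namely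
    A / ||A||, or the identity matrix if A = 0) and take every X_i equal to B.
    Then all summands coincide with ||A|| ^ (k - m) B ^t k, whose norm is
    ||A|| ^ (k - m).

    To avoid indexing placements, the sum is defined by recursion on k
    ([mixed_tensor]): the first slot receives either A or one of the X_i.
    With this definition the derivative formula ([is_diff_mixed_tensor]), the
    upper bound ([opnorm_mixed_tensor_le]) and the value at the extremal
    arguments ([mixed_tensor_nseq]) are inductions on k, the last two resting on
    the same recurrence for falling factorials ([ffact_expr_rec]).
    Multiplicativity of the norm is [opnorm_tens]. *)

Set Implicit Arguments.
Unset Strict Implicit.
Unset Printing Implicit Defensive.

Local Open Scope ring_scope.
Local Open Scope complex_scope.

(** * The differential of a tensor product *)

Section Calculus.
Variable K : numFieldType.

Lemma continuous_mx (T : topologicalType) m n (f : T -> 'M[K]_(m, n)) :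
  (forall i j, continuous (fun x => f x i j)) -> continuous f.
Proof.
move=> fc x U [P nP PU].
have : \forall y \near x, forall ij, P ij.1 ij.2 (f y ij.1 ij.2).
  apply: filter_forall => -[i j] /=.
  exact: (fc i j x _ (nP i j)).
by apply: filterS => y Py; apply: PU => i j; exact: (Py (i, j)).
Qed.

Lemma tensmx_is_bilinear m n p q :
  bilinear_for
    (GRing.Scale.Law.clone _ _ *:%R _) (GRing.Scale.Law.clone _ _ *:%R _)
    (@tensmx K m n p q).
Proof.
split=> [B|A] a X Y; apply/matrixP => i j /=; rewrite !mxE.
- by rewrite mulrDl mulrA.
- by rewrite mulrDr mulrCA.
Qed.

HB.instance Definition _ m n p q :=
  bilinear_isBilinear.Build K _ _ _ _ _ (@tensmx K m n p q)
    (@tensmx_is_bilinear m n p q).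

Lemma continuous_tensmx m n p q :
  continuous (fun M : 'M[K]_(m, n) * 'M[K]_(p, q) => M.1 *t M.2).
Proof.
apply: continuous_mx => i j M.
under [X in continuous_at _ X]eq_fun do rewrite mxE.
apply: continuousM.
  apply: (@continuous_comp _ _ _ fst (fun N : 'M[K]_(m, n) => N _ _)).
    exact: cvg_fst.
  exact: coord_continuous.
apply: (@continuous_comp _ _ _ snd (fun N : 'M[K]_(p, q) => N _ _)).
  exact: cvg_snd.
exact: coord_continuous.
Qed.

(** The product rule: the differential of a bilinear map composed with that of
    the pair (F, G). *)
Lemma is_diff_tensmx (V : normedModType K) m n p q
    (F dF : V -> 'M[K]_(m, n)) (G dG : V -> 'M[K]_(p, q)) (x : V) :
  is_diff x F dF -> is_diff x G dG ->
  is_diff x (fun y => F y *t G y) (fun y => F x *t dG y + dF y *t G x).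
Proof.
move=> dFx dGx.
pose b (M : 'M[K]_(m, n) * 'M[K]_(p, q)) := M.1 *t M.2.
have db : is_diff (F x, G x) b (fun M => F x *t M.2 + M.1 *t G x).
  apply: DiffDef.
    exact: (differentiable_bilin _ (@continuous_tensmx m n p q)).
  exact: (diff_bilin _ (@continuous_tensmx m n p q)).
exact: (@is_diff_comp _ _ _ _ (fun y => (F y, G y)) _ b _ x _ db).
Qed.
End Calculus.

(** * Iterated derivatives of the tensor power *)

(** Enumerates the choices of the direction that fills the first slot of a
    tensor product, each with the directions left for the other slots. *)
Fixpoint splits (T : Type) (s : seq T) : seq (T * seq T) :=
  if s is x :: s' then (x, s') :: [seq (p.1, x :: p.2) | p <- splits s']
  else [::].

Lemma size_splits T (s : seq T) : size (splits s) = size s.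
Proof. by elim: s => //= x s IHs; rewrite size_map IHs. Qed.

(** The sum of the tensor products of [k.+1] factors in which every entry of
    [Xs] occupies exactly one slot and [A] all the remaining ones; it is 0 if
    [Xs] has more than [k.+1] entries.  The recursion starts with one factor
    because [n ^ 1] is convertible to [n] but not to [n * n ^ 0], whereas
    [n ^ k.+2] is convertible to [n * n ^ k.+1]. *)
Fixpoint mixed_tensor (K : pzRingType) n k (Xs : seq 'M[K]_n) (A : 'M[K]_n) :
    'M[K]_(n ^ k.+1) :=
  if k is k'.+1 return 'M[K]_(n ^ k.+1) then
    A *t mixed_tensor k' Xs A +
    \sum_(p <- splits Xs) p.1 *t mixed_tensor k' p.2 A
  else match Xs with [::] => A | [:: X] => X | _ => 0 end.

Lemma mixed_tensor_nil (K : pzRingType) n k (A : 'M[K]_n) :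
  mixed_tensor k [::] A = A ^t k.+1.
Proof.
by elim: k => //= k ->; rewrite big_nil addr0.
Qed.

(** Differentiating in the direction [X] replaces one of the slots holding [A]
    by [X].  In the recursion, [X] in the first slot is the summand of
    [splits (X :: Xs)] that selects its head. *)
Lemma is_diff_mixed_tensor (K : numFieldType) n k (Xs : seq 'M[K]_n)
    (A : 'M[K]_n) :
  is_diff A (mixed_tensor k Xs) (fun X => mixed_tensor k (X :: Xs) A).
Proof.
elim: k Xs => [|k IHk] Xs.
  case: Xs => [|X [|Y Xs]] /=.
  - exact: is_diff_id.
  - exact: is_diff_cst.
  - exact: is_diff_cst.
have dsum (s : seq ('M[K]_n * seq 'M[K]_n)) :
    is_diff A (fun B => \sum_(p <- s) p.1 *t mixed_tensor k p.2 B)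
      (fun X => \sum_(p <- s) p.1 *t mixed_tensor k (X :: p.2) A).
  elim: s => [|p s IHs].
    under eq_fun do rewrite big_nil.
    under [X in is_diff _ _ X]eq_fun do rewrite big_nil.
    exact: is_diff_cst.
  under eq_fun do rewrite big_cons.
  under [X in is_diff _ _ X]eq_fun do rewrite big_cons.
  apply: is_diffD.
  apply: is_diff_eq.
    exact: (is_diff_tensmx (is_diff_cst p.1 A) (IHk p.2)).
  by apply/funext => X /=; rewrite tens0mx addr0.
apply: is_diff_eq.
  exact: (is_diffD (is_diff_tensmx (is_diff_id A) (IHk Xs)) (dsum (splits Xs))).
apply/funext => X /=.
by rewrite big_cons big_map !fctE -addrA.
Qed.

Lemma mderive_tensor_power (R : realType) n k m (A : 'M[R[i]]_n)
    (X : m.-tuple 'M[R[i]]_n) :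
  mderive m (tensor_power k.+1) A X = mixed_tensor k X A.
Proof.
rewrite /mderive; elim: (tval X) A => [|Y Ys IHs] A /=.
  by rewrite mixed_tensor_nil.
have -> : iter_diff (tensor_power k.+1) Ys = mixed_tensor k Ys by exact/funext.
by rewrite (@diff_val _ _ _ _ _ _ _ (is_diff_mixed_tensor k Ys A)).
Qed.

(** * The Euclidean norm *)

Section Euclnorm.
Variable R : realType.
Local Notation C := R[i].

Lemma normc_ge0 (z : C) : 0 <= normc z.
Proof. by case: z => a b; exact: sqrtr_ge0. Qed.

Lemma normc_real (a : R) : 0 <= a -> normc a%:C = a.
Proof. by move=> a0; rewrite /normc /= expr0n addr0 sqrtr_sqr ger0_norm. Qed.

Lemma euclnorm_ge0 n (x : 'cV[C]_n) : 0 <= euclnorm x.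
Proof. exact: sqrtr_ge0. Qed.

Lemma sqr_euclnorm n (x : 'cV[C]_n) :
  euclnorm x ^+ 2 = \sum_i normc (x i 0) ^+ 2.
Proof. by rewrite sqr_sqrtr // sumr_ge0 // => i _; exact: sqr_ge0. Qed.

Lemma euclnorm_eq0 n (x : 'cV[C]_n) : euclnorm x = 0 -> x = 0.
Proof.
move=> x0; have /esym := sqr_euclnorm x; rewrite x0 expr0n /= => /eqP.
rewrite psumr_eq0 => [/allP xi0|i _]; last exact: sqr_ge0.
apply/colP => i; rewrite mxE; apply: eq0_normc.
by have := xi0 i (mem_index_enum i); rewrite sqrf_eq0 => /eqP.
Qed.

Lemma euclnorm0 n : euclnorm (0 : 'cV[C]_n) = 0.
Proof.
rewrite /euclnorm big1 ?sqrtr0 // => i _.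
by rewrite mxE normc0 expr0n.
Qed.

Lemma euclnormZ n c (x : 'cV[C]_n) : euclnorm (c *: x) = normc c * euclnorm x.
Proof.
apply: (@pexpIrn _ 2); rewrite ?nnegrE ?mulr_ge0 ?euclnorm_ge0 ?normc_ge0 //.
rewrite exprMn !sqr_euclnorm mulr_sumr; apply: eq_bigr => i _.
by rewrite mxE normcM exprMn.
Qed.

Lemma normc_le_euclnorm n (x : 'cV[C]_n) i : normc (x i 0) <= euclnorm x.
Proof.
rewrite -(@ler_pXn2r _ 2) ?nnegrE ?euclnorm_ge0 ?normc_ge0 // sqr_euclnorm.
by rewrite (bigD1 i) //= lerDl sumr_ge0 // => j _; exact: sqr_ge0.
Qed.

(** Minkowski's inequality. With s and t the norms of x and y, both nonzero, it
    follows by summation over the coordinates from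
    s t (a + b)^2 <= (s + t) (t a^2 + s b^2), where the difference of the two
    sides is (t a - s b)^2. *)
Lemma euclnormD n (x y : 'cV[C]_n) :
  euclnorm (x + y) <= euclnorm x + euclnorm y.
Proof.
set s := euclnorm x; set t := euclnorm y.
have [/euclnorm_eq0 x0|s_neq0] := eqVneq s 0.
  by rewrite /s x0 add0r euclnorm0 add0r.
have [/euclnorm_eq0 y0|t_neq0] := eqVneq t 0.
  by rewrite /t y0 addr0 euclnorm0 addr0.
have s_gt0 : 0 < s by rewrite lt_neqAle eq_sym s_neq0 euclnorm_ge0.
have t_gt0 : 0 < t by rewrite lt_neqAle eq_sym t_neq0 euclnorm_ge0.
rewrite -(@ler_pXn2r _ 2) ?nnegrE ?addr_ge0 ?euclnorm_ge0 //.
rewrite -(ler_pM2l (mulr_gt0 s_gt0 t_gt0)).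
have -> : s * t * (s + t) ^+ 2 = (s + t) * (t * s ^+ 2 + s * t ^+ 2) by ring.
rewrite !sqr_euclnorm !mulr_sumr -big_split /= mulr_sumr.
apply: ler_sum => i _; rewrite mxE.
set a := normc (x i 0); set b := normc (y i 0).
have ab : normc (x i 0 + y i 0) ^+ 2 <= (a + b) ^+ 2.
  by rewrite ler_pXn2r ?nnegrE ?addr_ge0 ?normc_ge0 //; exact: le_normcD.
apply: (le_trans (ler_wpM2l _ ab)); first by rewrite mulr_ge0 ?euclnorm_ge0.
rewrite -subr_ge0.
have -> : (s + t) * (t * a ^+ 2 + s * b ^+ 2) - s * t * (a + b) ^+ 2 =
  (t * a - s * b) ^+ 2 by ring.
exact: sqr_ge0.
Qed.

Lemma euclnorm_delta n (i : 'I_n) : euclnorm (delta_mx i 0 : 'cV[C]_n) = 1.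
Proof.
rewrite /euclnorm (bigD1 i) //= big1 => [|j ji].
  by rewrite mxE !eqxx normc1 expr1n addr0 sqrtr1.
by rewrite mxE (negPf ji) normc0 expr0n.
Qed.

(** Needed for the supremum defining [opnorm] to be an upper bound; the bound
    uses only that the coordinates of a unit vector have modulus at most 1. *)
Lemma bounded_mulmx n (A : 'M[C]_n) :
  exists c, forall x : 'cV[C]_n, euclnorm x = 1 -> euclnorm (A *m x) <= c.
Proof.
exists (Num.sqrt (\sum_i (\sum_j normc (A i j)) ^+ 2)) => x x1.
apply/ler_wsqrtr/ler_sum => i _.
have S0 : 0 <= \sum_j normc (A i j).
  by rewrite sumr_ge0 // => j _; exact: normc_ge0.
rewrite ler_pXn2r ?nnegrE ?normc_ge0 // mxE.
have normc_sum (I : seq 'I_n) (F : 'I_n -> C) :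
    normc (\sum_(j <- I) F j) <= \sum_(j <- I) normc (F j).
  elim/big_rec2: _ => [|j b a _ ab]; first by rewrite normc0.
  by apply: (le_trans (le_normcD _ _)); rewrite lerD2l.
apply: (le_trans (normc_sum _ _)); apply: ler_sum => j _.
by rewrite normcM ler_piMr ?normc_ge0 // -x1 normc_le_euclnorm.
Qed.

End Euclnorm.

(** * The operator norm *)

Section Opnorm.
Variable R : realType.
Local Notation C := R[i].

Lemma le_opnorm_unit n (A : 'M[C]_n) (x : 'cV[C]_n) :
  euclnorm x = 1 -> euclnorm (A *m x) <= opnorm A.
Proof.
move=> x1; apply: ub_le_sup; last by exists x.
have [c cA] := bounded_mulmx A.
by exists c => _ [y y1 <-]; exact: cA.
Qed.

Lemma opnorm_le n (A : 'M[C]_n) c : 0 <= c ->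
  (forall x : 'cV[C]_n, euclnorm x = 1 -> euclnorm (A *m x) <= c) ->
  opnorm A <= c.
Proof.
move=> c0 Ac; rewrite /opnorm; set S := (X in sup X).
have [->|/set0P S0] := eqVneq S classical_sets.set0; first by rewrite sup0.
by apply: ge_sup => // _ [x x1 <-]; exact: Ac.
Qed.

Lemma opnorm_ge0 n (A : 'M[C]_n) : 0 <= opnorm A.
Proof.
(* In dimension 0 there is no unit vector, and the supremum is that of the
   empty set. *)
case: n A => [|n] A; last first.
  exact: le_trans (euclnorm_ge0 _) (le_opnorm_unit A (euclnorm_delta R ord0)).
rewrite /opnorm; set S := (X in sup X).
have [->|/set0P[_ [x x1 _]]] := eqVneq S classical_sets.set0.
  by rewrite sup0.
move/esym/eqP: x1; rewrite (_ : x = 0) ?euclnorm0 ?oner_eq0 //.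
by apply/colP => -[].
Qed.

Lemma le_opnorm n (A : 'M[C]_n) (x : 'cV[C]_n) :
  euclnorm (A *m x) <= opnorm A * euclnorm x.
Proof.
have [x0|x_neq0] := eqVneq (euclnorm x) 0.
  by rewrite (euclnorm_eq0 x0) mulmx0 !euclnorm0 mulr0.
have x_gt0 : 0 < euclnorm x by rewrite lt_neqAle eq_sym x_neq0 euclnorm_ge0.
have nV : normc (euclnorm x)^-1%:C = (euclnorm x)^-1.
  by rewrite normc_real // invr_ge0 euclnorm_ge0.
have := @le_opnorm_unit _ A ((euclnorm x)^-1%:C *: x).
rewrite -scalemxAr !euclnormZ nV mulVf // => /(_ erefl).
by rewrite ler_pdivrMl // mulrC.
Qed.

Lemma opnormD n (A B : 'M[C]_n) : opnorm (A + B) <= opnorm A + opnorm B.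
Proof.
apply: opnorm_le => [|x x1]; first by rewrite addr_ge0 ?opnorm_ge0.
rewrite mulmxDl; apply: (le_trans (euclnormD _ _)).
by rewrite lerD // le_opnorm_unit.
Qed.

Lemma opnorm0 n : opnorm (0 : 'M[C]_n) = 0.
Proof.
apply/eqP; rewrite eq_le opnorm_ge0 andbT.
by apply: opnorm_le => // x _; rewrite mul0mx euclnorm0.
Qed.

Lemma opnorm_sum n (I : Type) (s : seq I) (F : I -> 'M[C]_n) :
  opnorm (\sum_(i <- s) F i) <= \sum_(i <- s) opnorm (F i).
Proof.
elim/big_rec2: _ => [|i b a _ ab]; first by rewrite opnorm0.
by apply: (le_trans (opnormD _ _)); rewrite lerD2l.
Qed.

Lemma opnormZ n c (A : 'M[C]_n) : opnorm (c *: A) = normc c * opnorm A.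
Proof.
(* The converse inequality is this one for the scalar c^-1 and the matrix
   c *: A. *)
have leZ d (B : 'M[C]_n) : opnorm (d *: B) <= normc d * opnorm B.
  apply: opnorm_le => [|x x1]; first by rewrite mulr_ge0 ?normc_ge0 ?opnorm_ge0.
  by rewrite -scalemxAl euclnormZ ler_wpM2l ?normc_ge0 ?le_opnorm_unit.
have [->|c0] := eqVneq c 0; first by rewrite scale0r normc0 mul0r opnorm0.
apply/eqP; rewrite eq_le leZ /=.
have nc0 : 0 < normc c.
  rewrite lt_neqAle normc_ge0 andbT eq_sym.
  by apply: contra c0 => /eqP/eq0_normc->.
have := leZ c^-1 (c *: A).
by rewrite scalerA mulVf // scale1r normcV ler_pdivlMl.
Qed.

Lemma opnorm1 n : opnorm (1%:M : 'M[C]_n.+1) = 1.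
Proof.
apply/eqP; rewrite eq_le; apply/andP; split.
  by apply: opnorm_le => // x x1; rewrite mul1mx x1.
by have := le_opnorm_unit 1%:M (euclnorm_delta R (ord0 : 'I_n.+1));
  rewrite mul1mx euclnorm_delta.
Qed.

End Opnorm.

(** * Multiplicativity of the operator norm on tensor products *)

Section Tensor.
Variable R : realType.
Local Notation C := R[i].

(** The squared Hilbert-Schmidt norm. *)
Definition hsnorm2 m n (Z : 'M[C]_(m, n)) : R :=
  \sum_i \sum_j normc (Z i j) ^+ 2.

Lemma hsnorm2_tr m n (Z : 'M[C]_(m, n)) : hsnorm2 Z^T = hsnorm2 Z.
Proof.
rewrite /hsnorm2 exchange_big; apply: eq_bigr => i _; apply: eq_bigr => j _.
by rewrite mxE.
Qed.

(** Left multiplication by [A] acts separately on the columns of [Z]. *)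
Lemma hsnorm2_mulmx m n (A : 'M[C]_m) (Z : 'M[C]_(m, n)) :
  hsnorm2 (A *m Z) <= opnorm A ^+ 2 * hsnorm2 Z.
Proof.
have hs_col p (Y : 'M[C]_(p, n)) : hsnorm2 Y = \sum_j euclnorm (col j Y) ^+ 2.
  rewrite /hsnorm2 exchange_big; apply: eq_bigr => j _.
  by rewrite sqr_euclnorm; apply: eq_bigr => i _; rewrite mxE.
rewrite !hs_col mulr_sumr; apply: ler_sum => j _.
rewrite colE -mulmxA -colE -exprMn.
rewrite ler_pXn2r ?nnegrE ?mulr_ge0 ?euclnorm_ge0 ?opnorm_ge0 //.
exact: le_opnorm.
Qed.

Lemma sum_mxtens (V : nmodType) m n (F : 'I_(m * n) -> V) :
  \sum_k F k = \sum_i \sum_j F (mxtens_index (i, j)).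
Proof.
rewrite pair_big /= (reindex (@mxtens_index m n)) /=.
  by apply: eq_bigr => -[i j].
exists (@mxtens_unindex m n) => i _; first exact: mxtens_indexK.
exact: mxtens_unindexK.
Qed.

Definition unvec m n (z : 'cV[C]_(m * n)) : 'M[C]_(m, n) :=
  \matrix_(i, j) z (mxtens_index (i, j)) 0.

Lemma hsnorm2_unvec m n (z : 'cV[C]_(m * n)) :
  hsnorm2 (unvec z) = euclnorm z ^+ 2.
Proof.
rewrite sqr_euclnorm sum_mxtens; apply: eq_bigr => i _; apply: eq_bigr => j _.
by rewrite mxE.
Qed.

(** Once vectors of the tensor product are read as matrices, [A *t B] becomes
    left multiplication by [A] and right multiplication by the transpose of [B];
    this is what reduces its norm to those of [A] and [B]. *)
Lemma unvec_tensmx m n (A : 'M[C]_m) (B : 'M[C]_n) (z : 'cV[C]_(m * n)) :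
  unvec ((A *t B) *m z) = A *m unvec z *m B^T.
Proof.
apply/matrixP => i j; rewrite !mxE sum_mxtens exchange_big.
apply: eq_bigr => l _.
rewrite !mxE mulr_suml; apply: eq_bigr => k _.
by rewrite tensmxE mxE mulrAC.
Qed.

Lemma euclnorm_tens m n (x : 'cV[C]_m) (y : 'cV[C]_n) :
  euclnorm (x *t y : 'cV[C]_(m * n)) = euclnorm x * euclnorm y.
Proof.
apply: (@pexpIrn _ 2); rewrite ?nnegrE ?mulr_ge0 ?euclnorm_ge0 //.
rewrite exprMn !sqr_euclnorm sum_mxtens mulr_suml; apply: eq_bigr => i _.
rewrite mulr_sumr; apply: eq_bigr => j _.
by rewrite !mxE !mxtens_indexK /= normcM exprMn !ord1.
Qed.

Lemma opnorm_tens_le m n (A : 'M[C]_m) (B : 'M[C]_n) :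
  opnorm (A *t B) <= opnorm A * opnorm B.
Proof.
apply: opnorm_le => [|z z1]; first by rewrite mulr_ge0 ?opnorm_ge0.
rewrite -(@ler_pXn2r _ 2) ?nnegrE ?mulr_ge0 ?euclnorm_ge0 ?opnorm_ge0 //.
rewrite -hsnorm2_unvec unvec_tensmx -hsnorm2_tr trmx_mul trmxK.
apply: (le_trans (hsnorm2_mulmx _ _)); rewrite hsnorm2_tr.
rewrite exprMn mulrC ler_wpM2r ?sqr_ge0 //.
by apply: (le_trans (hsnorm2_mulmx _ _)); rewrite hsnorm2_unvec z1 expr1n mulr1.
Qed.

(** The lower bound comes from the product vectors x (x) y, on which both norms
    are multiplicative; the suprema over y and over x are taken in turn. *)
Lemma opnorm_tens m n (A : 'M[C]_m) (B : 'M[C]_n) :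
  opnorm (A *t B) = opnorm A * opnorm B.
Proof.
apply/eqP; rewrite eq_le opnorm_tens_le /=.
have lexy x y : euclnorm x = 1 -> euclnorm y = 1 ->
    euclnorm (A *m x) * euclnorm (B *m y) <= opnorm (A *t B).
  move=> x1 y1; rewrite -euclnorm_tens -tensmx_mul.
  by apply: le_opnorm_unit; rewrite euclnorm_tens x1 y1 mulr1.
have lex x : euclnorm x = 1 -> euclnorm (A *m x) * opnorm B <= opnorm (A *t B).
  move=> x1; have [->|Ax0] := eqVneq (euclnorm (A *m x)) 0.
    by rewrite mul0r opnorm_ge0.
  have Ax_gt0 : 0 < euclnorm (A *m x).
    by rewrite lt_neqAle eq_sym Ax0 euclnorm_ge0.
  rewrite mulrC -ler_pdivlMr //.
  apply: opnorm_le => [|y y1].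
    by rewrite divr_ge0 ?opnorm_ge0 ?euclnorm_ge0.
  by rewrite ler_pdivlMr // mulrC lexy.
have [->|B0] := eqVneq (opnorm B) 0; first by rewrite mulr0 opnorm_ge0.
have B_gt0 : 0 < opnorm B by rewrite lt_neqAle eq_sym B0 opnorm_ge0.
rewrite -ler_pdivlMr //.
apply: opnorm_le => [|x x1]; first by rewrite divr_ge0 ?opnorm_ge0.
by rewrite ler_pdivlMr // lex.
Qed.

Lemma opnorm_ntensmx n k (A : 'M[C]_n) : opnorm (A ^t k.+1) = opnorm A ^+ k.+1.
Proof.
elim: k => [|k IHk]; first by rewrite expr1.
by rewrite ntensmxSS exprS -IHk; exact: opnorm_tens.
Qed.

End Tensor.

(** * Norm of the mixed tensors *)

(** The recurrence behind [mixed_tensor], with a in place of A and 1 in place of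
    each direction: among n + 1 slots, the first holds either A, the s
    directions being spread over the n others, or one of the s directions.  For
    s = 0 the value [0.-1 = 0] does not matter, the second term being multiplied
    by s. *)
Lemma ffact_expr_rec (K : comPzRingType) n s (a : K) :
  a * ((n ^_ s)%:R * a ^+ (n - s)) + s%:R * ((n ^_ s.-1)%:R * a ^+ (n - s.-1))
  = (n.+1 ^_ s)%:R * a ^+ (n.+1 - s).
Proof.
case: s => [|s]; first by rewrite !ffactn0 mul0r addr0 !mul1r !subn0 exprS.
rewrite subSS /= ffactSS ffactnSr.
have [ns|sn] := leqP n s.
  have -> : (n - s = 0)%N by apply/eqP; rewrite subn_eq0.
  rewrite muln0 mul0r mulr0 add0r expr0 !mulr1 -natrM.
  move: ns; rewrite leq_eqVlt => /orP[/eqP->//|ns].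
  by rewrite ffact_small // !muln0.
have -> : a ^+ (n - s) = a * a ^+ (n - s.+1) by rewrite -exprS -subnSK.
have -> : (n.+1 = (n - s) + s.+1)%N by rewrite addnS subnK // ltnW.
rewrite !natrM natrD; ring.
Qed.

Lemma splits_nseq T m (x : T) :
  splits (nseq m x) = nseq m (x, nseq m.-1 x).
Proof.
elim: m => //= m ->; congr cons; rewrite map_nseq /=.
by case: m.
Qed.

(** When all directions are [B] and the base point is a multiple of [B], the
    placements all give the same tensor, so that the sum only counts them. *)
Lemma mixed_tensor_nseq (K : comPzRingType) n k m (a : K) (B : 'M[K]_n) :
  mixed_tensor k (nseq m B) (a *: B) =
  ((k.+1 ^_ m)%:R * a ^+ (k.+1 - m)) *: B ^t k.+1.
Proof.
elim: k m => [|k IHk] m.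
  case: m => [|[|m]] /=.
  - by rewrite ffactn0 mul1r expr1.
  - by rewrite ffactn1 mulr1 scale1r.
  - by rewrite ffact_small // mul0r scale0r.
have tensZ p q (c d : K) (X : 'M[K]_p) (Y : 'M[K]_q) :
    (c *: X) *t (d *: Y) = (c * d) *: (X *t Y).
  by apply/matrixP => i j; rewrite !mxE mulrACA.
rewrite /= IHk tensZ splits_nseq big_nseq iter_addr_0 /= IHk.
rewrite -[X in X *t _ *+ _]scale1r tensZ mul1r -scaler_nat scalerA -scalerDl.
by rewrite ffact_expr_rec ntensmxSS.
Qed.

Lemma mem_splits_perm (T : eqType) (s : seq T) p :
  p \in splits s -> perm_eq (p.1 :: p.2) s.
Proof.
elim: s p => //= x s IHs p; rewrite inE => /predU1P[-> //|/mapP[q /IHs qs ->]].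
rewrite -(perm_cons x) in qs; apply: perm_trans qs.
by rewrite (perm_catCA [:: q.1] [:: x] q.2).
Qed.

Lemma opnorm_mixed_tensor_le (R : realType) n k (Xs : seq 'M[R[i]]_n)
    (A : 'M[R[i]]_n) : all (fun X => opnorm X <= 1) Xs ->
  opnorm (mixed_tensor k Xs A) <=
  (k.+1 ^_ size Xs)%:R * opnorm A ^+ (k.+1 - size Xs).
Proof.
elim: k Xs => [|k IHk] Xs.
  case: Xs => [|X [|Y Xs]] /=.
  - by rewrite ffactn0 mul1r expr1.
  - by rewrite andbT ffactn1 mulr1.
  - by rewrite ffact_small // mul0r opnorm0.
move=> Xs1; rewrite -ffact_expr_rec.
apply: (le_trans (opnormD _ _)); apply: lerD.
  by rewrite [leLHS]opnorm_tens ler_wpM2l ?opnorm_ge0 ?IHk.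
apply: (le_trans (opnorm_sum _ _)).
set c := (X in _ <= _ * X).
have -> : (size Xs)%:R * c = \sum_(p <- splits Xs) c.
  by rewrite big_const_seq count_predT size_splits iter_addr_0 mulr_natl.
rewrite big_seq [leRHS]big_seq; apply: ler_sum => p /mem_splits_perm pXs.
have := Xs1; rewrite -(perm_all _ pXs) => /= /andP[p1 p2].
rewrite [leLHS]opnorm_tens -[leRHS]mul1r ler_pM ?opnorm_ge0 //.
by apply: (le_trans (IHk _ p2)); rewrite /c -(perm_size pXs).
Qed.

Lemma opnorm_mixed_tensor_nseq (R : realType) n k m (a : R) (B : 'M[R[i]]_n) :
  0 <= a -> opnorm B = 1 ->
  opnorm (mixed_tensor k (nseq m B) (a%:C *: B)) =
  (k.+1 ^_ m)%:R * a ^+ (k.+1 - m).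
Proof.
move=> a0 B1; rewrite mixed_tensor_nseq opnormZ opnorm_ntensmx B1 expr1n mulr1.
rewrite -(rmorphXn (real_complex R)) -(rmorph_nat (real_complex R)) -rmorphM.
by rewrite normc_real // mulr_ge0 ?exprn_ge0.
Qed.

(** Any unit matrix serves for [A = 0]; the dimension must be positive for one
    to exist. *)
Lemma opnorm_normalize (R : realType) n (A : 'M[R[i]]_n.+1) :
  exists2 B, opnorm B = 1 & A = (opnorm A)%:C *: B.
Proof.
have [A0|A_neq0] := eqVneq A 0.
  by exists 1%:M; [exact: opnorm1 | rewrite A0 opnorm0 scale0r].
have nA_neq0 : opnorm A != 0.
  apply: contra A_neq0 => /eqP nA0; apply/eqP/matrixP => i j; rewrite mxE.
  have := le_opnorm_unit A (euclnorm_delta R j); rewrite nA0 => le0.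
  have /euclnorm_eq0 : euclnorm (A *m delta_mx j 0) = 0.
    by apply/eqP; rewrite eq_le le0 euclnorm_ge0.
  by rewrite -colE => /colP/(_ i); rewrite !mxE.
exists ((opnorm A)^-1%:C *: A).
  by rewrite opnormZ normc_real ?invr_ge0 ?opnorm_ge0 // mulVf.
by rewrite scalerA -rmorphM divff // scale1r.
Qed.

Theorem theorem4p2 (R : realType) (n k : nat) (hn : (1 <= n)%N) (hk : (1 <= k)%N)
    (A : 'M[R[i]]_n) (m : nat) (hm : (1 <= m <= k)%N) :
  multi_opnorm (mderive m (tensor_power k) A)
  = k`!%:R / (k - m)`!%:R * opnorm A ^+ (k - m).
Proof.
case: n hn A => // n _ A; case: k hk hm => // k _ /andP[_ mk].
have -> : k.+1`!%:R / (k.+1 - m)`!%:R = (k.+1 ^_ m)%:R :> R.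
  by rewrite -(ffact_fact mk) natrM mulfK // pnatr_eq0 -lt0n fact_gt0.
(* The supremum is a maximum, attained when all m directions equal B. *)
have [B B1 AB] := opnorm_normalize A.
rewrite /multi_opnorm; set S := (X in sup X).
set c := (X in _ = X).
have Sc : S c.
  exists (nseq_tuple m B) => [i|]; first by rewrite tnth_nseq.
  rewrite mderive_tensor_power [in mixed_tensor _ _ A]AB.
  by rewrite opnorm_mixed_tensor_nseq ?opnorm_ge0.
have Sub : classical_sets.ubound S c.
  move=> _ [X X1 <-]; rewrite mderive_tensor_power.
  have := @opnorm_mixed_tensor_le _ _ k X A; rewrite size_tuple; apply.
  by apply/all_tnthP => i; rewrite X1.
apply/eqP; rewrite eq_le ge_sup //=; last by exists c.
by apply: ub_le_sup => //; exists c.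
Qed.
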